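(* Let $k\ge1$ and let $\mathcal S_{\mathrm a}$ be a convergent bivariate subdivision scheme with (real, finitely supported) mask $\mathrm a$. Then $\mathcal S_{\mathrm a}$ satisfies Condition $\mathrm Z_k$ if and only if its mask symbol can be written in the form $$\mathrm a(\boldsymbol z)=\sum_{B^\#_{\alpha,\beta,\gamma}\in \mathrm I_k}\lambda_{\alpha,\beta,\gamma}\;\sigma_{\alpha,\beta,\gamma}(\boldsymbol z)\;4\,B^\#_{\alpha,\beta,\gamma}(\boldsymbol z),$$ where the $\lambda_{\alpha,\beta,\gamma}$ are real numbers with $\sum\lambda_{\alpha,\beta,\gamma}=1$, and the $\sigma_{\alpha,\beta,\gamma}(\boldsymbol z)$ are Laurent polynomials normalized by $\sigma_{\alpha,\beta,\gamma}(1,1)=1$.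
   Context: A (bivariate) mask is a finitely supported sequence $\mathrm a=(\mathrm a_\alpha)_{\alpha\in\mathbb Z^2}$ of real numbers. The associated subdivision operator acts on sequences $\mathrm d=(\mathrm d_\alpha)_{\alpha\in\mathbb Z^2}$ by $(\mathcal S_{\mathrm a}\mathrm d)_\alpha=\sum_{\beta\in\mathbb Z^2}\mathrm d_\beta\,\mathrm a_{\alpha-2\beta}$. The mask symbol is the Laurent polynomial $\mathrm a(\boldsymbol z)=\sum_{\alpha\in\mathbb Z^2}\mathrm a_\alpha z_1^{\alpha_1}z_2^{\alpha_2}$, $\boldsymbol z=(z_1,z_2)\in(\mathbb C\setminus\{0\})^2$. The scheme is convergent if for every $\mathrm d\in\ell_\infty(\mathbb Z^2)$ there is a uniformly continuous function $f_{\mathrm d}$ on $\mathbb R^2$ with $\lim_{r\to\infty}\sup_{\alpha\in\mathbb Z^2}|(\mathcal S_{\mathrm a}^r\mathrm d)_\alpha-f_{\mathrm d}(2^{-r}\alpha)|=0$, and $f_{\mathrm d}\ne0$ for some $\mathrm d$. Condition $\mathrm Z_k$ (zero condition of order $k$): $\mathrm a(1,1)=4$ and $(D^{\mathbf j}\mathrm a)(\varepsilon)=0$ for all $\varepsilon\in\{-1,+1\}^2\setminus\{(1,1)\}$ and all $\mathbf j\in\mathbb N_0^2$ with $|\mathbf j|<k$, where $D^{\mathbf j}$ denotes the partial derivative of order $\mathbf j$. The normalized three-directional box spline symbols are $B^\#_{\alpha,\beta,\gamma}(z_1,z_2)=\bigl(\frac{1+z_1}{2}\bigr)^\alpha\bigl(\frac{1+z_2}{2}\bigr)^\beta\bigl(\frac{1+z_1z_2}{2}\bigr)^\gamma$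 for $\alpha,\beta,\gamma\in\mathbb N_0$, and $$\mathrm I_k=\bigl\{B^\#_{\beta,\beta,\alpha},\,B^\#_{\beta,\alpha,\beta},\,B^\#_{\alpha,\beta,\beta}\;:\;\alpha=0,1,\dots,\lfloor k/2\rfloor,\ \beta=k-\alpha\bigr\}.$$ Laurent polynomials are taken with real coefficients. *)

(* Defs.v *)
From HB Require Import structures.
From mathcomp Require Export all_boot all_order all_algebra finmap.
From mathcomp Require Export all_classical all_reals all_analysis.
From mathcomp.real_closed Require Export complex.
Set Implicit Arguments.
Unset Strict Implicit.
Unset Printing Implicit Defensive.
Import Order.TTheory GRing.Theory Num.Theory.
Import numFieldNormedType.Exports.
Local Open Scope classical_set_scope.
Local Open Scope complex_scope.
Local Open Scope ring_scope.

(* A mask and the coefficient family of a real Laurent polynomial in two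
   variables are the same thing: a finitely supported family over Z^2. *)
Definition mask (R : realType) := {fsfun (int * int)%type -> R with 0}.

Definition symbol (R : realType) (a : mask R) (z1 z2 : R[i]) : R[i] :=
  \sum_(m <- finsupp a) (a m)%:C * z1 ^ m.1 * z2 ^ m.2.

(* For fixed m the summand vanishes for all but finitely many b, so that the
   finitely-supported sum is the full sum over Z^2. *)
Definition subdiv (R : realType) (a : mask R) (d : int * int -> R) :
    int * int -> R :=
  fun m => \sum_(b \in [set: int * int]) d b * a (m - b *+ 2).

Definition bounded_seq (R : realType) (d : int * int -> R) : Prop :=
  exists M : R, forall m, `|d m| <= M.

Definition dyadic (R : realType) (r : nat) (m : int * int) : R * R :=
  (m.1%:~R / 2 ^+ r, m.2%:~R / 2 ^+ r).

(* The supremum is taken in the extended reals: the real-valued [sup] of an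
   unbounded set is 0. *)
Definition subdiv_limit (R : realType) (a : mask R) (d : int * int -> R)
    (f : R * R -> R) : Prop :=
  unif_continuous f /\
  (ereal_sup [set `|iter r (subdiv a) d m - f (dyadic R r m)|%:E
               | m in [set: int * int]] @[r --> \oo] --> 0%E).

Definition convergent (R : realType) (a : mask R) : Prop :=
  (forall d, bounded_seq d -> exists f, subdiv_limit a d f) /\
  (exists d f, [/\ bounded_seq d, subdiv_limit a d f & exists x, f x != 0]).

Definition partial (C : numFieldType) (j : nat * nat) (F : C -> C -> C)
    (z1 z2 : C) : C :=
  derive1n j.1 (fun w1 : C => derive1n j.2 (F w1) z2) z1.

Definition condZ (R : realType) (k : nat) (a : mask R) : Prop :=
  symbol a 1 1 = 4 /\
  forall e1 e2 : R[i], e1 = 1 \/ e1 = - 1 -> e2 = 1 \/ e2 = - 1 ->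
    (e1, e2) <> (1, 1) ->
    forall j : nat * nat, (j.1 + j.2 < k)%N ->
      partial j (symbol a) e1 e2 = 0.

Definition box_spline (R : realType) (t : nat * nat * nat) (z1 z2 : R[i]) :
    R[i] :=
  let: (al, be, ga) := t in
  ((1 + z1) / 2) ^+ al * ((1 + z2) / 2) ^+ be * ((1 + z1 * z2) / 2) ^+ ga.

(* Distinct triples give distinct box spline symbols, so the set of symbols is
   indexed by its set of exponent triples; for even k the three triples with
   al = k./2 coincide and count once. *)
Definition Iset (k : nat) : set (nat * nat * nat) :=
  [set t | exists2 al, (al <= k./2)%N & let be := (k - al)%N in
     [\/ t = (be, be, al), t = (be, al, be) | t = (al, be, be)]].

(* Main.v *)
From HB Require Import structures.
Require Import Defs.
From mathcomp Require Import ring zify.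
Import Order.TTheory GRing.Theory Num.Theory.
Import numFieldNormedType.Exports.
Local Open Scope classical_set_scope.
Local Open Scope complex_scope.
Local Open Scope ring_scope.
Set Implicit Arguments.
Unset Strict Implicit.
Unset Printing Implicit Defensive.

(** Put x = (1 + z1) / 2, y = (1 + z2) / 2 and w = (1 + z1 z2) / 2, so that the
    box spline symbols are the monomials x^p y^q w^r. In the ring of real
    Laurent polynomials the three excluded points are the zero sets of pairs of
    these factors: x and w generate the maximal ideal of (-1, 1), y and w that
    of (1, -1), and x and y that of (-1, -1). The zero condition of order k thus
    says that the symbol lies in (x, w)^k, in (y, w)^k and in (x, y)^k, besides
    taking the value 4 at (1, 1) ([condZE]).

    That vanishing derivatives give membership in a power of the maximal ideal
    is a Taylor argument made one degree at a time ([ideal_pow_of_deriv_at]): an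
    element of the n-th power is a form of degree n with constant coefficients,
    up to the next power, and the derivatives of order n at the point read off
    these coefficients. The only analytic input is the formula for the
    derivatives of a Laurent monomial ([partial_laurent]).

    The heart of the matter is that the intersection of the three powers is
    generated by the k-th family of box splines ([ideal_gen_of_ideal_pow]). A
    monomial x^p y^q w^r whose exponents have pairwise sums at least k is a
    multiple of some member of the family ([Iset_below]). So if f lies in all
    three powers, then w^k f lies in the generated ideal, because f is a
    combination of x^i y^j with i + j = k; likewise for x^k f and y^k f. Finally
    x + y + w = 1 + 2 x y, so x^k, y^k and w^k generate the unit ideal, and f
    itself lies in the generated ideal.

    This yields coefficients g_t with the symbol equal to the sum of the g_t B_t
    but says nothing about g_t (1, 1), whereas a coefficient lambda sigma with
    sigma (1, 1) = 1 and value 0 at (1, 1) must vanish identically. The Koszul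
    relations B_r B_t - B_t B_r = 0 repair this: since every B_t takes the value
    1 at (1, 1), adding multiples of them redistributes the values g_t (1, 1)
    arbitrarily among the t, keeping their sum, so that they can all be made
    equal ([koszul_sum0]). *)

(** * Ideals and their powers *)

Definition is_ideal (A : comPzRingType) (I : A -> Prop) : Prop :=
  [/\ I 0, forall f g, I f -> I g -> I (f + g) & forall c f, I f -> I (c * f)].

Lemma ideal_sum (A : comPzRingType) (I : A -> Prop) (J : Type) (s : seq J)
    (F : J -> A) :
  is_ideal I -> (forall j, I (F j)) -> I (\sum_(j <- s) F j).
Proof. by case=> I0 ID _ IF; elim/big_ind: _. Qed.

(** In the binomial expansion of exponent n + m, each term has n factors a or m
    factors b. *)
Lemma ideal_exprD (A : comPzRingType) (I : A -> Prop) (a b : A) (n m : nat) :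
  is_ideal I -> I (a ^+ n) -> I (b ^+ m) -> I ((a + b) ^+ (n + m)).
Proof.
move=> II Ia Ib; rewrite exprDn; apply: ideal_sum => // i.
have [_ _ IM] := II; rewrite -mulr_natl; apply: (IM).
have [le_mi|lt_im] := leqP m i.
  by rewrite -(subnK le_mi) exprD; do 2!apply: (IM).
have le_n : (n <= n + m - i)%N by lia.
by rewrite -(subnK le_n) exprD mulrC; do 2!apply: (IM).
Qed.

Lemma ideal_unimodular (A : comPzRingType) (I : A -> Prop) (a b c : A)
    (n : nat) :
  is_ideal I -> a + b + c = 1 -> I (a ^+ n) -> I (b ^+ n) -> I (c ^+ n) -> I 1.
Proof.
move=> II abc Ia Ib Ic; rewrite -(expr1n A (n + n + n)) -abc.
by do 2!apply: ideal_exprD => //.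
Qed.

(** The n-th power of the ideal (u, v). The recursive form makes properties of
    the powers follow by induction from one multiplication by u or v. *)
Fixpoint ideal_pow (A : comPzRingType) (u v : A) (n : nat) (f : A) : Prop :=
  if n is n'.+1 then
    exists g h, [/\ ideal_pow u v n' g, ideal_pow u v n' h & f = u * g + v * h]
  else True.

Lemma is_ideal_pow (A : comPzRingType) (u v : A)
    (n : nat) : is_ideal (ideal_pow u v n).
Proof.
elim: n => [|n [I0 ID IM]] //=; split.
- by exists 0, 0; split=> //; ring.
- move=> _ _ [g [h [gn hn ->]]] [g' [h' [gn' hn' ->]]].
  by exists (g + g'), (h + h'); split; [exact: ID|exact: ID|ring].
- move=> c _ [g [h [gn hn ->]]].
  by exists (c * g), (c * h); split; [exact: IM|exact: IM|ring].
Qed.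

Lemma ideal_pow_sub (A : comPzRingType) (u v u' v' : A) (n : nat) (f : A) :
  ideal_pow u v 1 u' -> ideal_pow u v 1 v' -> ideal_pow u' v' n f ->
      ideal_pow u v n f.
Proof.
move=> [a [b [_ _ ->]]] [c [d [_ _ ->]]].
elim: n f => //= n IH _ [g [h [/IH gn /IH hn ->]]].
have [_ ID IM] := is_ideal_pow u v n.
exists (a * g + c * h), (b * g + d * h); split; last by ring.
- by apply: (ID); apply: IM.
- by apply: (ID); apply: IM.
Qed.

Lemma ideal_pow_monomial (A : comPzRingType) (u v : A) (i j n : nat) (c : A) :
  (n <= i + j)%N -> ideal_pow u v n (c * u ^+ i * v ^+ j).
Proof.
elim: n i j => [|n IH] [|i] [|j] //= le_n.
- exists 0, (c * u ^+ 0 * v ^+ j); split; last by rewrite !exprS; ring.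
  + by case: (is_ideal_pow u v n).
  + by apply: IH; lia.
- exists (c * u ^+ i * v ^+ 0), 0; split; last by rewrite !exprS; ring.
  + by apply: IH; lia.
  + by case: (is_ideal_pow u v n).
- exists (c * u ^+ i * v ^+ j.+1), 0; split; last by rewrite !exprS; ring.
  + by apply: IH; lia.
  + by case: (is_ideal_pow u v n).
Qed.

(** Multiplication by c sends the n-th power of (u, v) into I as soon as it
    sends the monomials of degree n there; the exponents i and j are those
    already split off in the induction. *)
Lemma ideal_pow_sub_ideal (A : comPzRingType) (I : A -> Prop) (u v c : A)
    (n i j : nat) (f : A) :
    is_ideal I ->
    (forall p q, (i + j + n <= p + q)%N -> I (c * u ^+ p * v ^+ q)) ->
  ideal_pow u v n f -> I (c * u ^+ i * v ^+ j * f).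
Proof.
move=> [_ ID IM]; elim: n i j f => [|n IH] i j f Imon /=.
  by move=> _; rewrite mulrC; apply/IM/Imon; rewrite addn0.
move=> [g [h [gn hn ->]]].
rewrite (_ : _ * _ = c * u ^+ i.+1 * v ^+ j * g + c * u ^+ i * v ^+ j.+1 * h).
  by apply: ID; apply: IH => // p q le_pq; apply: Imon; lia.
by rewrite !exprS; ring.
Qed.

(** * The exponents of the box splines *)

(** If the smallest of the three exponents is at most k / 2, take it as the
    exponent that occurs once, and k minus it as the other two, which the
    pairwise sums allow. Otherwise all three exceed k / 2 and the balanced
    member of the family divides. *)
Lemma Iset_below (k p q r : nat) :
  (k <= p + q)%N -> (k <= p + r)%N -> (k <= q + r)%N ->
  exists t, [/\ Iset k t, (t.1.1 <= p)%N, (t.1.2 <= q)%N & (t.2 <= r)%N].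
Proof.
move=> pq pr qr.
have [rk|kr] := leqP r k./2.
  by exists (k - r, k - r, r)%N; split=> /=; [exists r => //;
      apply: Or31|lia..].
have [qk|kq] := leqP q k./2.
  by exists (k - q, q, k - q)%N; split=> /=;
    [exists q => //; apply: Or32|lia..].
have [pk|kp] := leqP p k./2.
  by exists (p, k - p, k - p)%N; split=> /=;
    [exists p => //; apply: Or33|lia..].
by exists (k - k./2, k - k./2, k./2)%N; split=> /=;
  [exists k./2 => //; apply: Or31|lia..].
Qed.

Lemma Iset_sums (k : nat) (t : nat * nat * nat) : Iset k t ->
  [/\ (k <= t.1.1 + t.1.2)%N, (k <= t.1.1 + t.2)%N & (k <= t.1.2 + t.2)%N].
Proof.
by move=> [al le_al] /= [] -> /=; split; lia.
Qed.

Lemma Iset_finite (k : nat) : finite_set (Iset k).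
Proof.
apply: (@sub_finite_set _ _ ((`I_k.+1 `*` `I_k.+1) `*` `I_k.+1)).
  by move=> t [al alk [] -> /=]; do 2?split=> /=; lia.
by do 2!apply: finite_setX => //; exact: finite_II.
Qed.

(** * The ideal generated by the box splines *)

Definition monomial3 (A : comPzRingType) (x y w : A)
    (t : nat * nat * nat) : A :=
  x ^+ t.1.1 * y ^+ t.1.2 * w ^+ t.2.

Definition ideal_gen (A : comPzRingType) (J : Type) (s : seq J) (B : J -> A)
    (f : A) : Prop :=
  exists g : J -> A, f = \sum_(t <- s) g t * B t.

Lemma is_ideal_gen (A : comPzRingType) (J : Type) (s : seq J) (B : J -> A) :
  is_ideal (ideal_gen s B).
Proof.
split.
- by exists (fun=> 0); rewrite big1// => t _; rewrite mul0r.
- move=> _ _ [g ->] [h ->]; exists (fun t => g t + h t).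
  by rewrite -big_split; apply: eq_bigr => t _; rewrite mulrDl.
- move=> c _ [g ->]; exists (fun t => c * g t).
  by rewrite mulr_sumr; apply: eq_bigr => t _; rewrite mulrA.
Qed.

Lemma ideal_gen_mem (A : comPzRingType) (J : eqType) (s : seq J) (B : J -> A)
    (t : J) : uniq s -> t \in s -> ideal_gen s B (B t).
Proof.
move=> us ts; exists (fun u => (u == t)%:R).
rewrite (bigD1_seq t)//= eqxx mul1r big1 ?addr0// => u /negPf->.
by rewrite mul0r.
Qed.

Lemma ideal_gen_monomial3 (A : comPzRingType) (x y w : A) (k p q r : nat)
    (s : seq (nat * nat * nat)) :
    uniq s -> (forall t, Iset k t -> t \in s) ->
  (k <= p + q)%N -> (k <= p + r)%N -> (k <= q + r)%N ->
  ideal_gen s (monomial3 x y w) (monomial3 x y w (p, q, r)).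
Proof.
move=> us sI pq pr qr; have [[[p' q'] r'] [/sI ts /= lep leq' ler]] :=
    Iset_below pq pr qr.
have [_ _ IM] := is_ideal_gen s (monomial3 x y w).
rewrite (_ : monomial3 _ _ _ _ = monomial3 x y w (p - p', q - q', r - r')%N *
   monomial3 x y w (p', q', r')); first by apply: IM; apply: ideal_gen_mem.
rewrite /monomial3 /= -{1}(subnK lep) -{1}(subnK leq') -{1}(subnK ler) !exprD.
by ring.
Qed.

(** The multipliers c with c f in the generated ideal form an ideal. It contains
    x^k, y^k and w^k: each of these supplies the missing variable to an
    expansion of f in the two others. The relation between x, y and w makes
    x (1 - 2 y), y and w add up to 1. *)
Lemma ideal_gen_of_ideal_pow (A : comPzRingType) (x y w : A) (k : nat)
    (s : seq (nat * nat * nat)) (f : A) :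
    uniq s -> (forall t, Iset k t -> t \in s) ->
    x + y + w = 1 + 2 * x * y ->
    ideal_pow x w k f -> ideal_pow y w k f -> ideal_pow x y k f ->
  ideal_gen s (monomial3 x y w) f.
Proof.
move=> us sI xyw fxw fyw fxy; have II := is_ideal_gen s (monomial3 x y w).
have [I0 ID IM] := II.
rewrite -[f]mul1r; pose I c := ideal_gen s (monomial3 x y w) (c * f).
have IdI : is_ideal I.
  split; rewrite /I; first by rewrite mul0r.
    by move=> c d Ic Id; rewrite mulrDl; apply: ID.
  by move=> c d Id; rewrite -mulrA; apply: IM.
have abc : x * (1 - 2 * y) + y + w = 1.
  by rewrite -[RHS](addrK (2 * x * y)) -xyw; ring.
apply: (ideal_unimodular (n := k) IdI abc).
- rewrite exprMn mulrC; case: IdI => _ _; apply; rewrite /I.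
  rewrite -[x ^+ k]mulr1 -[_ * 1]mulr1.
  apply: (ideal_pow_sub_ideal (i := 0) (j := 0) II _ fyw) => p q le_pq.
  by apply: (ideal_gen_monomial3 x y w (k := k) (p := k)) => //; lia.
- rewrite /I -[y ^+ k]mulr1 -[_ * 1]mulr1.
  apply: (ideal_pow_sub_ideal (i := 0) (j := 0) II _ fxw) => p q le_pq.
  rewrite (mulrC (y ^+ k)); apply: (ideal_gen_monomial3 x y w (k := k) (q :=
      k)) => //; lia.
- rewrite /I -[w ^+ k]mulr1 -[_ * 1]mulr1.
  apply: (ideal_pow_sub_ideal (i := 0) (j := 0) II _ fxy) => p q le_pq.
  rewrite -mulrA mulrC; apply: (ideal_gen_monomial3 x y w (k := k) (r :=
      k)) => //; lia.
Qed.

(** Here h plays the part of 1/2. Up to units, z2 - 1 and w differ by a multiple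
    of x because z1 (z2 - 1) = 2 w - 2 x; this is why the inverses of z1 and z2
    are needed, and why the pairs of factors generate the maximal ideals of the
    three points. *)
Section LocalIdeals.
Variables (A : comPzRingType) (h z1 z2 z1V z2V : A).
Hypotheses (h2 : 2 * h = 1) (z1K : z1V * z1 = 1) (z2K : z2V * z2 = 1).
Let x := h * (1 + z1).
Let y := h * (1 + z2).
Let w := h * (1 + z1 * z2).

Let hK (a : A) : 2 * (h * a) = a.
Proof. by rewrite mulrA h2 mul1r. Qed.

Lemma ideal_pow_xy (n : nat) (f : A) : ideal_pow x y n f <->
    ideal_pow (z1 + 1) (z2 + 1) n f.
Proof.
split; apply: ideal_pow_sub.
- by exists h, 0; split=> //; rewrite /x; ring.
- by exists 0, h; split=> //; rewrite /y; ring.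
- by exists 2, 0; split=> //; rewrite -[LHS]hK /x; ring.
- by exists 0, 2; split=> //; rewrite -[LHS]hK /y; ring.
Qed.

Lemma ideal_pow_xw (n : nat) (f : A) : ideal_pow x w n f <->
    ideal_pow (z1 + 1) (z2 - 1) n f.
Proof.
split; apply: ideal_pow_sub.
- by exists h, 0; split=> //; rewrite /x; ring.
- by exists h, (h * z1); split=> //; rewrite /w; ring.
- by exists 2, 0; split=> //; rewrite -[LHS]hK /x; ring.
- exists (- 2 * z1V), (2 * z1V); split=> //.
  rewrite [RHS](_ : _ = (2 * h) * (z1V * z1) * (z2 - 1)); last first.
    by rewrite /x /w; ring.
  by rewrite h2 z1K !mul1r.
Qed.

Lemma ideal_pow_yw (n : nat) (f : A) : ideal_pow y w n f <->
    ideal_pow (z1 - 1) (z2 + 1) n f.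
Proof.
split; apply: ideal_pow_sub.
- by exists 0, h; split=> //; rewrite /y; ring.
- by exists (h * z2), h; split=> //; rewrite /w; ring.
- exists (- 2 * z2V), (2 * z2V); split=> //.
  rewrite [RHS](_ : _ = (2 * h) * (z2V * z2) * (z1 - 1)); last first.
    by rewrite /y /w; ring.
  by rewrite h2 z2K !mul1r.
- by exists 2, 0; split=> //; rewrite -[LHS]hK /y; ring.
Qed.

Lemma partition_xyw : x + y + w = 1 + 2 * x * y.
Proof.
transitivity (2 * (h * 1) + h * (1 + z1) * (1 + z2)).
  by rewrite /x /y /w; ring.
rewrite [RHS](_ : _ = 1 + (2 * (h * (h * (1 + z1) * (1 + z2))))); last first.
  by rewrite /x /y; ring.
by rewrite !hK.
Qed.
End LocalIdeals.

(** The matrix with entries v r - v t is antisymmetric, so the sum is a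
    combination of the Koszul relations between the B t. If all B t take the
    value 1 at a point, the inner sum there is the total of v minus the number
    of terms times v t: subtracting deviations from the mean. *)
Lemma koszul_sum0 (A : comPzRingType) (J : Type) (s : seq J) (B v : J -> A) :
  \sum_(t <- s) (\sum_(r <- s) (v r - v t) * B r) * B t = 0.
Proof.
transitivity (\sum_(t <- s) \sum_(r <- s) v r * B r * B t -
  \sum_(t <- s) \sum_(r <- s) v t * B r * B t).
  rewrite -sumrB; apply: eq_bigr => t _; rewrite -sumrB mulr_suml.
  by apply: eq_bigr => r _; rewrite !mulrBl.
apply/eqP; rewrite subr_eq0 exchange_big; apply/eqP/eq_bigr => t _.
by apply: eq_bigr => r _; ring.
Qed.

(** * Derivatives of Laurent polynomials *)

(** The falling factorial of an integer, possibly negative: the coefficient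
    that appears when z ^ m is differentiated j times. *)
Definition fallz (C : pzRingType) (m : int) (j : nat) : C :=
  \prod_(i < j) (m - i%:Z)%:~R.

Lemma is_derive_expz (C : numFieldType) (m : int) (x : C) : x != 0 ->
  is_derive x 1 (fun z : C => z ^ m) (m%:~R * x ^ (m - 1)).
Proof.
move=> x0; case: (intP m) => [|n|n].
- apply: is_derive_eq; first exact: (is_derive_cst (1 : C)).
  by rewrite mul0r.
- have dz : derivable (fun z : C => z ^ n.+1%:Z) x 1 :=
    @exprn_derivable C n.+1 x 1.
  apply: (DeriveDef dz).
  have -> := @exp_derive C n.+1 x 1; rewrite /= [_ *: 1]mulr1.
  by rewrite (_ : n.+1%:Z - 1 = n%:Z)//; lia.
- have fE : (fun z : C => z ^ (- n.+1%:Z)) = (fun z => (z ^+ n.+1)^-1).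
    by apply/funext => z; rewrite exprnN.
  have xn0 : x ^+ n.+1 != 0 by rewrite expf_neq0.
  rewrite fE; apply: DeriveDef.
    by apply: derivableV => //; exact: (@exprn_derivable C n.+1 x 1).
  rewrite deriveV//; last exact: (@exprn_derivable C n.+1 x 1).
  have -> := @exp_derive C n.+1 x 1; rewrite /= [_ *: 1]mulr1.
  rewrite (_ : - n.+1%:Z - 1 = - n.+2%:Z); last by lia.
  rewrite -exprnN rmorphN /= /GRing.scale /= -!exprM -pmulrn.
  rewrite (_ : (n.+1 * 2)%N = (n + n.+2)%N); last by lia.
  by rewrite exprD; field; rewrite !expf_neq0.
Qed.

(** The formula for f is only known off 0, which suffices since the derivative
    at x depends on f near x alone. *)
Lemma derive1_laurent (C : numFieldType) (J : Type) (s : seq J) (c : J -> C)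
    (m : J -> int) (f : C -> C) (x : C) : x != 0 ->
    (forall z, z != 0 -> f z = \sum_(p <- s) c p * z ^ m p) ->
  derive1 f x = \sum_(p <- s) c p * (m p)%:~R * x ^ (m p - 1).
Proof.
move=> x0 fE; rewrite derive1E.
rewrite (@near_eq_derive _ _ _ _ (fun z : C =>
    \sum_(p <- s) c p * z ^ m p : C)).
  apply: (@derive_val _ _ _ _ _ _ _ _).
  elim: s {fE} => [|p s IH].
    rewrite big_nil (_ : (fun z : C => _) = cst 0); last first.
      by apply/funext => z; rewrite big_nil.
    exact: is_derive_cst.
  rewrite big_cons (_ : (fun z : C => _) = (c p \*o (fun z => z ^ m p)) +
    (fun z => \sum_(p <- s) c p * z ^ m p)); last first.
    by apply/funext => z; rewrite big_cons.
  apply: is_deriveD.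
  have [dz zE] := is_derive_expz (m p) x0.
  apply: DeriveDef; first exact: (derivableM (derivable_cst (c p) x 1) dz).
  by rewrite deriveMl// zE mulrA.
apply/nbhs_ballP; exists `|x|; first by rewrite /= normr_gt0.
move=> z; rewrite -(@ball_normE _ C) /= => xz; apply: fE.
by apply: contraTneq xz => ->; rewrite subr0 ltxx.
Qed.

Lemma derive1n_laurent (C : numFieldType) (J : Type) (s : seq J) (c : J -> C)
    (m : J -> int) (f : C -> C) (j : nat) (x : C) : x != 0 ->
    (forall z, z != 0 -> f z = \sum_(p <- s) c p * z ^ m p) ->
  derive1n j f x = \sum_(p <- s) c p * fallz C (m p) j * x ^ (m p - j%:Z).
Proof.
move=> x0 fE; elim: j x x0 => [|j IH] x x0.
  rewrite derive1n0 fE//; apply: eq_bigr => p _.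
  by rewrite /fallz big_ord0 mulr1 subr0.
rewrite derive1nS (derive1_laurent x0 IH); apply: eq_bigr => p _.
rewrite /fallz big_ord_recr /= mulrA; congr (_ * _ ^ _); lia.
Qed.

Lemma partial_laurent (C : numFieldType) (J : Type) (s : seq J) (c : J -> C)
    (m : J -> int * int) (F : C -> C -> C) (j : nat * nat) (e1 e2 : C) :
    e1 != 0 -> e2 != 0 ->
    (forall z1 z2, z1 != 0 -> z2 != 0 ->
       F z1 z2 = \sum_(p <- s) c p * z1 ^ (m p).1 * z2 ^ (m p).2) ->
  partial j F e1 e2 = \sum_(p <- s) c p *
    (fallz C (m p).1 j.1 * e1 ^ ((m p).1 - j.1%:Z)) *
    (fallz C (m p).2 j.2 * e2 ^ ((m p).2 - j.2%:Z)).
Proof.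
move=> e10 e20 FE; rewrite /partial.
rewrite (derive1n_laurent (s := s) (c := fun p => c p *
  (fallz C (m p).2 j.2 * e2 ^ ((m p).2 - j.2%:Z))) (m := fun p => (m p).1)) //.
  by apply: eq_bigr => p _; ring.
move=> z z0; rewrite (derive1n_laurent (s := s) (c := fun p => c p *
  z ^ (m p).1) (m := fun p => (m p).2)) //.
- by apply: eq_bigr => p _; ring.
- by move=> z2 z20; rewrite FE.
Qed.

(** Leibniz rule for z * z ^ m. *)
Lemma fallzS (C : comPzRingType) (m : int) (j : nat) :
  fallz C (m + 1) j = fallz C m j + j%:R * fallz C m j.-1.
Proof.
case: j => [|j]; first by rewrite /fallz !big_ord0 mul0r addr0.
rewrite /= {1}/fallz big_ord_recl [fallz C m j.+1]/fallz big_ord_recr /=.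
rewrite (_ : \prod_(i < j) _ = fallz C m j).
  by rewrite -/(fallz C m j) !rmorphB !rmorphD /= -pmulrn -natr1; ring.
by apply: eq_bigr => i _; congr (_%:~R); rewrite /= /bump; lia.
Qed.

Lemma fallz_expS (C : fieldType) (m : int) (j : nat) (e : C) : e != 0 ->
  fallz C (m + 1) j * e ^ (m + 1 - j%:Z) =
  e * (fallz C m j * e ^ (m - j%:Z)) +
  j%:R * (fallz C m j.-1 * e ^ (m - j.-1%:Z)).
Proof.
move=> e0; rewrite fallzS (_ : m + 1 - j%:Z = m - j%:Z + 1); last by lia.
rewrite expfzDr// expr1z; case: j => [|n] /=; first by ring.
rewrite (_ : m - n%:Z = m - n.+1%:Z + 1); last by lia.
by rewrite [_ ^ (_ + 1)]expfzDr// expr1z; ring.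
Qed.

Lemma leibniz_term1 (C : comPzRingType) (c e a b j y : C) :
  c * (e * a + j * b) * y + - e * c * a * y = j * (c * b * y).
Proof. by ring. Qed.

Lemma leibniz_term2 (C : comPzRingType) (c e a b j y : C) :
  c * y * (e * a + j * b) + - e * c * y * a = j * (c * y * b).
Proof. by ring. Qed.

(** * The ring of Laurent polynomials *)

Section Laurent.
Variable R : realType.

Definition torus := {z : R[i] * R[i] | (z.1 != 0) && (z.2 != 0)}.

Definition terms_eval (s : seq (R * (int * int))) (z1 z2 : R[i]) : R[i] :=
  \sum_(p <- s) p.1%:C * z1 ^ p.2.1 * z2 ^ p.2.2.

(** Laurent polynomials are represented by the functions that they define on
    the torus: ring identities can then be checked pointwise, and z1 and z2 are
    invertible. *)
Definition is_laurent : pred (torus -> R[i]) :=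
  fun f => `[< exists s, forall z, f z = terms_eval s (val z).1 (val z).2 >].

Lemma torusP (z : torus) : (val z).1 != 0 /\ (val z).2 != 0.
Proof. by apply/andP; exact: (valP z). Qed.

Lemma is_laurent_subring : subring_closed is_laurent.
Proof.
split.
- apply/asboolP; exists [:: (1, (0, 0))] => z.
  by rewrite /terms_eval big_seq1 /= !expr0z !mulr1.
- move=> f g /asboolP[s fE] /asboolP[t gE]; apply/asboolP.
  exists (s ++ [seq (- p.1, p.2) | p <- t]) => z.
  rewrite /terms_eval big_cat big_map /= -/(terms_eval _ _ _) -fE;
      congr (_ + _).
  rewrite -[LHS]/(- g z) gE -sumrN; apply: eq_bigr => p _.
  by rewrite rmorphN /= !mulNr.
- move=> f g /asboolP[s fE] /asboolP[t gE]; apply/asboolP.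
  exists [seq (p.1 * q.1, p.2 + q.2) | p <- s, q <- t] => z.
  have [z10 z20] := torusP z.
  rewrite /terms_eval big_allpairs_dep /= -[LHS]/(f z * g z) fE gE.
  rewrite mulr_suml; apply: eq_bigr => p _.
  rewrite mulr_sumr; apply: eq_bigr => q _ /=.
  by rewrite rmorphM /= !expfzDr//; ring.
Qed.

HB.instance Definition _ :=
  GRing.isSubringClosed.Build _ is_laurent is_laurent_subring.

Record laurent := Laurent { laurent_fun :> torus ->
    R[i]; _ : is_laurent laurent_fun }.

HB.instance Definition _ := [isSub for laurent_fun].
HB.instance Definition _ := [Choice of laurent by <:].
HB.instance Definition _ :=
  GRing.SubChoice_isSubComPzRing.Build _ _ laurent (subringClosedP _).

End Laurent.

Section LaurentTheory.
Variable R : realType.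
Implicit Types (s : seq (R * (int * int))) (f g : laurent R) (c : R).

Lemma is_laurent_terms_eval s :
  is_laurent (fun z : torus R => terms_eval s (val z).1 (val z).2).
Proof. by apply/asboolP; exists s. Qed.

Definition of_terms s : laurent R := Laurent (is_laurent_terms_eval s).

Lemma of_termsE s (z : torus R) : of_terms s z =
    terms_eval s (val z).1 (val z).2.
Proof. by []. Qed.

Lemma laurentP f g : (forall z, f z = g z) -> f = g.
Proof. by move=> fg; apply/val_inj/funext. Qed.

Lemma of_terms_surj f : exists s, f = of_terms s.
Proof.
by case: (f) => F /= /[dup] /asboolP[s Fs] lF; exists s; apply: laurentP.
Qed.

Lemma evalD f g z : (f + g) z = f z + g z. Proof. by []. Qed.
Lemma evalN f z : (- f) z = - f z. Proof. by []. Qed.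
Lemma evalM f g z : (f * g) z = f z * g z. Proof. by []. Qed.

Lemma eval_sum (J : Type) (r : seq J) (F : J -> laurent R) (z : torus R) :
  (\sum_(i <- r) F i) z = \sum_(i <- r) F i z.
Proof. by apply: (big_morph (fun f : laurent R => f z)). Qed.

Lemma evalX f n z : (f ^+ n) z = f z ^+ n.
Proof. by elim: n => // n IH; rewrite !exprS evalM IH. Qed.

Definition lconst c : laurent R := of_terms [:: (c, (0, 0))].
Definition Z1 : laurent R := of_terms [:: (1, (1, 0))].
Definition Z2 : laurent R := of_terms [:: (1, (0, 1))].
Definition Z1V : laurent R := of_terms [:: (1, (-1, 0))].
Definition Z2V : laurent R := of_terms [:: (1, (0, -1))].

Lemma lconstE c z : lconst c z = c%:C.
Proof. by rewrite of_termsE /terms_eval big_seq1 /= !expr0z !mulr1. Qed.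
Lemma Z1E z : Z1 z = (val z).1.
Proof. by rewrite of_termsE /terms_eval big_seq1 /= mulr1 mul1r expr1z. Qed.
Lemma Z2E z : Z2 z = (val z).2.
Proof. by rewrite of_termsE /terms_eval big_seq1 /= mulr1 mul1r expr1z. Qed.
Lemma Z1VE z : Z1V z = (val z).1^-1.
Proof. by rewrite of_termsE /terms_eval big_seq1 /= mulr1 mul1r. Qed.
Lemma Z2VE z : Z2V z = (val z).2^-1.
Proof. by rewrite of_termsE /terms_eval big_seq1 /= mulr1 mul1r. Qed.

Lemma Z1VK : Z1V * Z1 = 1.
Proof.
apply: laurentP => z; have [z10 _] := torusP z.
by rewrite evalM Z1VE Z1E mulVf.
Qed.

Lemma Z2VK : Z2V * Z2 = 1.
Proof.
apply: laurentP => z; have [_ z20] := torusP z.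
by rewrite evalM Z2VE Z2E mulVf.
Qed.

Lemma lconstD c d : lconst (c + d) = lconst c + lconst d.
Proof. by apply: laurentP => z; rewrite evalD !lconstE rmorphD. Qed.
Lemma lconstM c d : lconst (c * d) = lconst c * lconst d.
Proof. by apply: laurentP => z; rewrite evalM !lconstE rmorphM. Qed.
Lemma lconstN c : lconst (- c) = - lconst c.
Proof. by apply: laurentP => z; rewrite evalN !lconstE rmorphN. Qed.
Lemma lconst0 : lconst 0 = 0.
Proof. by apply: laurentP => z; rewrite !lconstE. Qed.
Lemma lconst1 : lconst 1 = 1.
Proof. by apply: laurentP => z; rewrite !lconstE. Qed.
Lemma lconst2K : 2 * lconst 2^-1 = 1.
Proof.
apply: laurentP => z; rewrite evalM lconstE -[(2 : laurent R) z]/(2 : R[i]).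
by rewrite -[2]/(2%:R) -(rmorph_nat (real_complex R)) -rmorphM /= mulfV.
Qed.

(** The ring is generated by the constants, the coordinates and their
    inverses. *)
Lemma laurent_ind (P : laurent R -> Prop) :
    (forall c, P (lconst c)) -> P Z1 -> P Z1V -> P Z2 -> P Z2V ->
    (forall f g, P f -> P g -> P (f + g)) ->
    (forall f g, P f -> P g -> P (f * g)) ->
  forall f, P f.
Proof.
move=> Pc P1 P1V P2 P2V PD PM f; have [s ->] := of_terms_surj f.
have P1z m : P (of_terms [:: (1, (m, 0))]).
  elim/int_ind: m => [|n IH|n IH]; first exact: Pc.
  - rewrite (_ : of_terms _ =
      Z1 * of_terms [:: (1, (n%:Z, 0))]); first exact: PM.
    apply: laurentP => z; rewrite evalM Z1E !of_termsE /terms_eval !big_seq1 /=.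
    by rewrite mulr1 !mul1r mulr1 -exprnP exprS.
  - rewrite (_ : of_terms _ =
      Z1V * of_terms [:: (1, (- n%:Z, 0))]); first exact: PM.
    apply: laurentP => z;
        rewrite evalM Z1VE !of_termsE /terms_eval !big_seq1 /=.
    by rewrite mulr1 !mul1r mulr1 -!exprnN exprS invfM.
have P2z m : P (of_terms [:: (1, (0, m))]).
  elim/int_ind: m => [|n IH|n IH]; first exact: Pc.
  - rewrite (_ : of_terms _ =
      Z2 * of_terms [:: (1, (0, n%:Z))]); first exact: PM.
    apply: laurentP => z; rewrite evalM Z2E !of_termsE /terms_eval !big_seq1 /=.
    by rewrite mulr1 !mul1r -exprnP exprS.
  - rewrite (_ : of_terms _ =
      Z2V * of_terms [:: (1, (0, - n%:Z))]); first exact: PM.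
    apply: laurentP => z;
        rewrite evalM Z2VE !of_termsE /terms_eval !big_seq1 /=.
    by rewrite mulr1 !mul1r -!exprnN exprS invfM.
elim: s => [|[c [m1 m2]] s IH].
  rewrite (_ : of_terms _ = lconst 0); first exact: Pc.
  by apply: laurentP => z; rewrite lconstE of_termsE /terms_eval big_nil.
rewrite (_ : of_terms _ =
    lconst c * of_terms [:: (1, (m1, 0))] * of_terms [:: (1, (0, m2))] +
  of_terms s); first by apply: PD => //; do 2!apply: (PM) => //.
apply: laurentP => z;
    rewrite evalD !evalM lconstE !of_termsE /terms_eval big_cons !big_seq1.
by rewrite /= expr0z !mulr1 !mul1r.
Qed.

(** The elements congruent to a real constant form a subring, and it contains
    the generators because e1 and e2 are their own inverses. *)
Lemma laurent_const_mod (e1 e2 : R) f : e1 ^+ 2 = 1 -> e2 ^+ 2 = 1 ->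
  exists c, ideal_pow (Z1 - lconst e1) (Z2 - lconst e2) 1 (f - lconst c).
Proof.
move=> e1K e2K; set u := Z1 - _; set v := Z2 - _.
have [_ ID IM] := is_ideal_pow u v 1.
have inv (e : R) (Z ZV : laurent R) : e ^+ 2 = 1 -> ZV * Z = 1 ->
    ideal_pow u v 1 (Z - lconst e) -> ideal_pow u v 1 (ZV - lconst e).
  move=> eK ZK /(IM (- ZV * lconst e)); congr ideal_pow.
  rewrite mulrBr -!mulrA -lconstM -expr2 eK lconst1 mulr1 (mulrC (lconst e)).
  by rewrite !mulNr mulrA ZK mul1r opprK addrC.
have Iu : ideal_pow u v 1 (Z1 - lconst e1) by exists 1, 0; split=> //;
    rewrite -/u; ring.
have Iv : ideal_pow u v 1 (Z2 - lconst e2) by exists 0, 1; split=> //;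
    rewrite -/v; ring.
elim/laurent_ind: f => [c|||||f g [c fc] [d gd]|f g [c fc] [d gd]].
- by exists c; rewrite subrr; case: (is_ideal_pow u v 1).
- by exists e1.
- by exists e1; apply: inv Iu => //; exact: Z1VK.
- by exists e2.
- by exists e2; apply: inv Iv => //; exact: Z2VK.
- exists (c + d); rewrite lconstD (_ : _ - _ = (f - lconst c) + (g - lconst d)).
    exact: ID.
  by ring.
- exists (c * d).
  rewrite lconstM (_ : _ - _ = g * (f - lconst c) + lconst c * (g - lconst d)).
    by apply: (ID); apply: IM.
  by ring.
Qed.

(** The leading form at (e1, e2), by replacing the coefficients of the monomials
    of degree k by constants to which they are congruent. *)
Lemma ideal_pow_leading (e1 e2 : R) k f : e1 ^+ 2 = 1 -> e2 ^+ 2 = 1 ->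
  let u := Z1 - lconst e1 in let v := Z2 - lconst e2 in
  ideal_pow u v k f -> exists c : nat -> R,
    ideal_pow u v k.+1 (f - \sum_(i < k.+1) lconst (c i) * u ^+ i *
        v ^+ (k - i)).
Proof.
move=> e1K e2K u v; elim: k f => [|k IH] f.
  move=> _; have [c fc] := laurent_const_mod f e1K e2K.
  by exists (fun=> c); rewrite big_ord1 !expr0 !mulr1.
move=> [g [h [/IH[c gc] /IH[d hd] ->]]].
exists (fun i => (if i is i'.+1 then c i' else 0) +
  (if (i <= k)%N then d i else 0)).
do 2!eexists; split; [exact: gc|exact: hd|].
rewrite !mulrBr addrACA -opprD; congr (_ - _).
under eq_bigr do rewrite lconstD !mulrDl; rewrite big_split /=; congr (_ + _).
  rewrite big_ord_recl lconst0 !mul0r add0r mulr_sumr; apply: eq_bigr => i _.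
  by rewrite /= /bump /= add1n subSS exprS; ring.
rewrite big_ord_recr /= ltnn lconst0 !mul0r addr0 mulr_sumr.
apply: eq_bigr => i _; have ik : (i <= k)%N by rewrite -ltnS.
by rewrite ik subSn// exprS; ring.
Qed.

Definition one_torus : torus R.
Proof. by exists (1, 1); rewrite /= oner_neq0. Defined.

(** Iterated derivatives are taken of functions of two complex variables, so
    functions on the torus are extended, with the value at (1, 1) off it. *)
Definition torus_point (z1 z2 : R[i]) : torus R := insubd one_torus (z1, z2).

Lemma torus_pointK z1 z2 : z1 != 0 -> z2 != 0 -> val (torus_point z1 z2) =
    (z1, z2).
Proof. by move=> z10 z20; rewrite insubdK//; apply/andP. Qed.

(** * Vanishing derivatives and powers of the maximal ideal *)

Definition deriv_at (e1 e2 : R) (j : nat * nat) f : R[i] :=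
  partial j (fun z1 z2 => f (torus_point z1 z2)) e1%:C e2%:C.

Variables (e1 e2 : R).
Hypotheses (e10 : e1 != 0) (e20 : e2 != 0).

Let e10C : e1%:C != 0.
Proof. by rewrite fmorph_eq0. Qed.
Let e20C : e2%:C != 0.
Proof. by rewrite fmorph_eq0. Qed.

Lemma deriv_at_of_terms j s : deriv_at e1 e2 j (of_terms s) =
    \sum_(p <- s) p.1%:C *
    (fallz R[i] p.2.1 j.1 * e1%:C ^ (p.2.1 - j.1%:Z)) *
    (fallz R[i] p.2.2 j.2 * e2%:C ^ (p.2.2 - j.2%:Z)).
Proof.
rewrite /deriv_at.
have FE z1 z2 : z1 != 0 -> z2 != 0 ->
  of_terms s (torus_point z1 z2) =
      \sum_(p <- s) p.1%:C * z1 ^ p.2.1 * z2 ^ p.2.2.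
  by move=> z10 z20; rewrite of_termsE torus_pointK.
by rewrite (@partial_laurent _ _ s (fun p => p.1%:C) (fun p =>
    p.2) _ j _ _ e10C e20C FE).
Qed.

Lemma deriv_atD j f g : deriv_at e1 e2 j (f + g) =
    deriv_at e1 e2 j f + deriv_at e1 e2 j g.
Proof.
have [[s ->] [t ->]] := (of_terms_surj f, of_terms_surj g).
rewrite (_ : of_terms s + of_terms t = of_terms (s ++ t)).
  by rewrite !deriv_at_of_terms big_cat.
by apply: laurentP => z; rewrite evalD !of_termsE /terms_eval big_cat.
Qed.

(** Leibniz rule at a zero of the factor: only the term where that factor is
    differentiated once survives. *)
Lemma deriv_at_subM1 j f : deriv_at e1 e2 j ((Z1 - lconst e1) * f) =
  j.1%:R * deriv_at e1 e2 (j.1.-1, j.2) f.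
Proof.
have [s ->] := of_terms_surj f.
rewrite (_ : _ * _ = of_terms ([seq (p.1, (p.2.1 + 1, p.2.2)) | p <- s] ++
   [seq (- e1 * p.1, p.2) | p <- s])); last first.
  apply: laurentP => z; have [z10 z20] := torusP z.
  rewrite evalM evalD evalN Z1E lconstE !of_termsE /terms_eval big_cat !big_map
      /= mulrBl.
  rewrite !mulr_sumr -sumrN; congr (_ + _); apply: eq_bigr => p _.
    by rewrite expfzDr// expr1z; ring.
  by rewrite rmorphM rmorphN /=; ring.
rewrite !deriv_at_of_terms big_cat !big_map /= -big_split mulr_sumr.
apply: eq_bigr => p _ /=; rewrite rmorphM rmorphN /= fallz_expS//.
exact: leibniz_term1.
Qed.

Lemma deriv_at_subM2 j f : deriv_at e1 e2 j ((Z2 - lconst e2) * f) =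
  j.2%:R * deriv_at e1 e2 (j.1, j.2.-1) f.
Proof.
have [s ->] := of_terms_surj f.
rewrite (_ : _ * _ = of_terms ([seq (p.1, (p.2.1, p.2.2 + 1)) | p <- s] ++
   [seq (- e2 * p.1, p.2) | p <- s])); last first.
  apply: laurentP => z; have [z10 z20] := torusP z.
  rewrite evalM evalD evalN Z2E lconstE !of_termsE /terms_eval big_cat !big_map
      /= mulrBl.
  rewrite !mulr_sumr -sumrN; congr (_ + _); apply: eq_bigr => p _.
    by rewrite expfzDr// expr1z; ring.
  by rewrite rmorphM rmorphN /=; ring.
rewrite !deriv_at_of_terms big_cat !big_map /= -big_split mulr_sumr.
apply: eq_bigr => p _ /=; rewrite rmorphM rmorphN /= fallz_expS//.
exact: leibniz_term2.
Qed.

Local Notation u := (Z1 - lconst e1).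
Local Notation v := (Z2 - lconst e2).

(** When i exceeds the order in z1 or l the order in z2, the falling factorial
    is 0, so the truncated subtractions do no harm. *)
Lemma deriv_at_monomial (i l : nat) j f : deriv_at e1 e2 j (f * u ^+ i *
    v ^+ l) =
  (j.1 ^_ i)%:R * (j.2 ^_ l)%:R * deriv_at e1 e2 (j.1 - i, j.2 - l)%N f.
Proof.
elim: i j => [|i IHi] j; first elim: l j => [|l IHl] j.
- by rewrite !mulr1 !ffactn0 !mul1r !subn0; case: j.
- rewrite exprS mulrCA deriv_at_subM2 IHl /= !ffactn0 ffactnS !mul1r natrM
    mulrA.
  by rewrite (_ : j.2.-1 - l = j.2 - l.+1)%N //; lia.
- rewrite (_ : f * _ * _ = u * (f * u ^+ i * v ^+ l)); last first.
    by rewrite exprS; ring.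
  rewrite deriv_at_subM1 IHi /= ffactnS natrM.
  by rewrite !mulrA (_ : j.1.-1 - i = j.1 - i.+1)%N //; lia.
Qed.

Lemma deriv_at_ideal_pow k f : ideal_pow u v k f ->
  forall j : nat * nat, (j.1 + j.2 < k)%N -> deriv_at e1 e2 j f = 0.
Proof.
elim: k f => //= k IH _ [g [h [/IH gk /IH hk ->]]] [[|j1] [|j2]] /= jk.
- by rewrite deriv_atD deriv_at_subM1 deriv_at_subM2 !mul0r addr0.
- by rewrite deriv_atD deriv_at_subM1 deriv_at_subM2 mul0r add0r hk ?mulr0.
- by rewrite deriv_atD deriv_at_subM1 deriv_at_subM2 mul0r addr0 gk ?mulr0 //=
    addn0; lia.
- by rewrite deriv_atD deriv_at_subM1 deriv_at_subM2 gk ?hk ?mulr0 ?addr0//=;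
    lia.
Qed.

Lemma deriv_at_const c : deriv_at e1 e2 (0, 0)%N (lconst c) = c%:C.
Proof.
by rewrite deriv_at_of_terms big_seq1 /fallz !big_ord0 /= !subr0 !expr0z !mulr1.
Qed.

(** Induction on k: f has a leading form of degree k, and the derivative of
    order (i, k - i) at the point is i! (k - i)! times its i-th coefficient. *)
Lemma ideal_pow_of_deriv_at k f : e1 ^+ 2 = 1 -> e2 ^+ 2 = 1 ->
    (forall j : nat * nat, (j.1 + j.2 < k)%N -> deriv_at e1 e2 j f = 0) ->
  ideal_pow u v k f.
Proof.
move=> e1K e2K; elim: k => // k IH fk.
have /(ideal_pow_leading e1K e2K)[c fc] : ideal_pow u v k f.
  by apply: IH => j jk; apply: fk; exact: ltnW.
suff c0 (i : 'I_k.+1) : c i = 0.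
  rewrite big1 ?subr0// in fc.
  by move=> i _; rewrite c0 lconst0 !mul0r.
have ik : (i <= k)%N by rewrite -ltnS.
have jk : ((i : nat) + (k - i) < k.+1)%N by rewrite subnKC.
have fc0 := deriv_at_ideal_pow fc (j := (i : nat, k - i)%N) jk.
have := fk (i : nat, k - i)%N jk; rewrite -{1}[f](subrK
  (\sum_(i < k.+1) lconst (c i) * u ^+ i * v ^+ (k - i))) deriv_atD.
rewrite fc0 add0r.
have Dsum (J : Type) (r : seq J) (F : J -> laurent R) j :
    deriv_at e1 e2 j (\sum_(a <- r) F a) = \sum_(a <- r) deriv_at e1 e2 j (F a).
  apply: (big_morph _ (deriv_atD j)).
  by apply: (@addIr _ (deriv_at e1 e2 j 0)); rewrite -deriv_atD !add0r.
rewrite Dsum (bigD1 i)//= big1 ?addr0 => [|l li]; last first.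
  rewrite deriv_at_monomial /=; have [il|il|il] := ltngtP i l.
  - by rewrite ffact_small// !mul0r.
  - rewrite [X in _ * X%:R]ffact_small ?mulr0 ?mul0r//; lia.
  - by move: li; rewrite -val_eqE /= il eqxx.
rewrite deriv_at_monomial /= !subnn deriv_at_const !ffactnn => /eqP.
by rewrite !mulf_eq0 !pnatr_eq0 !eqn0Ngt !fact_gt0 /= fmorph_eq0 => /eqP.
Qed.

End LaurentTheory.

(** * Masks *)

Section Masks.
Variable R : realType.
Implicit Types (a : mask R) (f g : laurent R).

Definition of_mask a : laurent R := of_terms [seq (a m, m) | m <- finsupp a].

Lemma of_maskE a z : of_mask a z = symbol a (val z).1 (val z).2.
Proof. by rewrite of_termsE /terms_eval big_map. Qed.

(** Collecting the coefficients of equal monomials. *)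
Lemma to_mask f : exists a : mask R,
  forall z1 z2 : R[i], z1 != 0 -> z2 != 0 -> symbol a z1 z2 =
      f (torus_point z1 z2).
Proof.
have [s ->] := of_terms_surj f.
pose D : {fset int * int} := [fset m in [seq p.2 | p <- s]]%fset.
pose F (m : int * int) : R := \sum_(p <- s | p.2 == m) p.1.
exists [fsfun m in D => F m | 0] => z1 z2 z10 z20.
rewrite of_termsE torus_pointK// /symbol /terms_eval.
rewrite (big_fset_incl _ (finsupp_sub _ _ _)) /=; last first.
  by move=> m _; rewrite memNfinsupp => /eqP ->; rewrite !mul0r.
transitivity (\sum_(m <- D) \sum_(p <- s | p.2 == m)
  p.1%:C * z1 ^ p.2.1 * z2 ^ p.2.2).
  rewrite big_seq [RHS]big_seq; apply: eq_bigr => m mD.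
  rewrite fsfunE mD /F rmorph_sum /= !mulr_suml.
  by apply: eq_bigr => p /eqP <-.
rewrite (exchange_big_dep predT)//= big_seq [RHS]big_seq.
apply: eq_bigr => p ps; rewrite -big_filter (_ : [seq m <- _ | _] = [:: p.2]).
  by rewrite big_seq1.
rewrite (eq_filter (a2 := pred1 p.2)); last first.
  by move=> m; rewrite [RHS]eq_sym.
by apply: filter_pred1_uniq; rewrite ?fset_uniq// in_fset map_f.
Qed.

Lemma deriv_at_of_mask a (e1 e2 : R) j : e1 != 0 -> e2 != 0 ->
  partial j (symbol a) e1%:C e2%:C = deriv_at e1 e2 j (of_mask a).
Proof.
move=> e10 e20; rewrite deriv_at_of_terms// big_map.
by apply: (@partial_laurent _ _ _ (fun m => (a m)%:C) id);
  rewrite ?fmorph_eq0.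
Qed.

Lemma laurent_at1_real f : exists v : R, f (one_torus R) = v%:C.
Proof.
have [s ->] := of_terms_surj f; exists (\sum_(p <- s) p.1).
rewrite of_termsE rmorph_sum; apply: eq_bigr => p _ /=.
by rewrite !exp1rz !mulr1.
Qed.

Local Notation h := (lconst (2^-1 : R)).
Definition factor1 : laurent R := h * (1 + Z1 R).
Definition factor2 : laurent R := h * (1 + Z2 R).
Definition factor12 : laurent R := h * (1 + Z1 R * Z2 R).

Lemma box_splineE t z : monomial3 factor1 factor2 factor12 t z =
    box_spline t (val z).1 (val z).2.
Proof.
case: t => [[al be] ga];
    rewrite /monomial3 !evalM !evalX /factor1 /factor2 /factor12.
rewrite !evalM !evalD !evalM.
rewrite Z1E Z2E lconstE -[(1 : laurent R) z]/(1 : R[i]).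
have -> : (2^-1)%:C = 2^-1 :> R[i].
  by rewrite fmorphV rmorph_nat.
by rewrite /= ![2^-1 * _]mulrC.
Qed.

Lemma condZE k a : condZ k a <-> [/\ symbol a 1 1 = 4,
  ideal_pow factor1 factor12 k (of_mask a),
      ideal_pow factor2 factor12 k (of_mask a) &
  ideal_pow factor1 factor2 k (of_mask a)].
Proof.
have N1 : (-1 : R) != 0 by rewrite oppr_eq0 oner_neq0.
have P1 : (1 : R) != 0 by rewrite oner_neq0.
have key (e1 e2 : R) : e1 = 1 \/ e1 = -1 -> e2 = 1 \/ e2 = -1 ->
    ideal_pow (Z1 R - lconst e1) (Z2 R - lconst e2) k (of_mask a) <->
    forall j : nat * nat, (j.1 + j.2 < k)%N ->
      partial j (symbol a) e1%:C e2%:C = 0.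
  move=> e1E e2E.
  have e10 : e1 != 0 by case: e1E => ->.
  have e20 : e2 != 0 by case: e2E => ->.
  have e1K : e1 ^+ 2 = 1 by case: e1E => ->; rewrite ?sqrrN expr1n.
  have e2K : e2 ^+ 2 = 1 by case: e2E => ->; rewrite ?sqrrN expr1n.
  split=> [I j jk|Z].
    by rewrite deriv_at_of_mask// (deriv_at_ideal_pow e10 e20 I).
  by apply: ideal_pow_of_deriv_at => // j jk; rewrite -deriv_at_of_mask// Z.
have CN1 : (-1 : R)%:C = -1 by rewrite rmorphN rmorph1.
have LN1 : lconst (-1 : R) = -1 by rewrite lconstN lconst1.
have := key (-1) 1 (or_intror erefl) (or_introl erefl).
have := key 1 (-1) (or_introl erefl) (or_intror erefl).
have := key (-1) (-1) (or_intror erefl) (or_intror erefl).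
rewrite LN1 lconst1 CN1 !opprK => Kxy Kyw Kxw.
have {}Kxy := iff_trans (ideal_pow_xy (Z1 R) (Z2 R) (lconst2K R) _ _) Kxy.
have {}Kyw := iff_trans (ideal_pow_yw (Z1 R) (lconst2K R) (Z2VK R) _ _) Kyw.
have {}Kxw := iff_trans (ideal_pow_xw (Z2 R) (lconst2K R) (Z1VK R) _ _) Kxw.
have neq1N1 : (-1 : R[i]) <> 1.
  by move/eqP; rewrite eq_sym -addr_eq0 -mulr2n pnatr_eq0.
split=> [[a4 Z]|[a4 /Kxw Zxw /Kyw Zyw /Kxy Zxy]]; split=> //.
- by apply/Kxw => j; apply: Z; [right|left|move=> /(congr1 fst)/neq1N1].
- by apply/Kyw => j; apply: Z; [left|right|move=> /(congr1 snd)/neq1N1].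
- by apply/Kxy => j; apply: Z; [right|right|move=> /(congr1 fst)/neq1N1].
- by move=> _ _ [->|->] [->|->].
Qed.

End Masks.

(** * The characterization *)

Theorem theoremC (R : realType) (k : nat) (hk : (1 <= k)%N) (a : mask R)
    (ha : convergent a) :
  condZ k a <->
  exists (lam : nat * nat * nat -> R) (sigma : nat * nat * nat -> mask R),
    [/\ \sum_(t \in Iset k) lam t = 1,
        forall t, Iset k t -> symbol (sigma t) 1 1 = 1 &
        forall z1 z2 : R[i], z1 != 0 -> z2 != 0 ->
          symbol a z1 z2 =
          \sum_(t \in Iset k)
             (lam t)%:C * symbol (sigma t) z1 z2 * (4 * box_spline t z1 z2)].
Proof.
have Ifin := Iset_finite k.
have one_neq0 : (1 : R[i]) != 0 by exact: oner_neq0.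
have box1 t : box_spline t (1 : R[i]) 1 = 1.
  case: t => [[al be] ga] /=; rewrite mulr1.
  have two0 : (2 : R[i]) != 0 by rewrite (pnatr_eq0 R[i] 2).
  by rewrite (divff two0) !expr1n !mulr1.
rewrite condZE; split=> [[a4 axw ayw axy]|[lam [sigma [lam1 sig1 aE]]]].
- set s := fset_set (Iset k).
  have sI t : Iset k t -> t \in (s : seq _).
    by move=> It; rewrite in_fset_set// inE.
  have us : uniq s by exact: fset_uniq.
  have [B [g [BE gE]]] : exists B g : nat * nat * nat -> laurent R,
      (forall t z, B t z = box_spline t (val z).1 (val z).2) /\
      of_mask a = \sum_(t <- s) g t * B t.
    have xyw := partition_xyw (Z1 R) (Z2 R) (lconst2K R).
    have [g gE] := ideal_gen_of_ideal_pow us sI xyw axw ayw axy.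
    by exists (monomial3 (factor1 R) (factor2 R) (factor12 R)), g;
        split=> // t z; exact: box_splineE.
  have /choice[v vE] t := laurent_at1_real (g t).
  have B1 t : B t (one_torus R) = 1 by rewrite BE box1.
  have vsum : \sum_(t <- s) v t = 4.
    apply: (fmorph_inj (real_complex R)).
    rewrite rmorph_sum rmorph_nat -a4 /=.
    rewrite -[RHS](of_maskE a (one_torus R)) gE eval_sum.
    by apply: eq_bigr => t _; rewrite evalM B1 mulr1 vE.
  pose N : R := (size s)%:R.
  have N0 : N != 0.
    apply/eqP => /eqP; rewrite pnatr_eq0 size_eq0 => /eqP s0.
    by move: vsum; rewrite s0 big_nil => /esym/eqP; rewrite (pnatr_eq0 R 4).
  (* Since the values v t add up to 4, each g' t takes the value 4 / N. *)
  pose g' t : laurent R :=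
      g t + \sum_(r <- s) (lconst (v r / N) - lconst (v t / N)) * B r.
  have g'E : of_mask a = \sum_(t <- s) g' t * B t.
    rewrite gE /g'; under [RHS]eq_bigr do rewrite mulrDl.
    by rewrite big_split /= koszul_sum0 addr0.
  have g'1 t : g' t (one_torus R) = (4 / N)%:C.
    rewrite evalD vE eval_sum.
    under eq_bigr do rewrite evalM evalD evalN !lconstE B1 mulr1 -rmorphB.
    rewrite -rmorph_sum -rmorphD sumrB -mulr_suml vsum; congr (_%:C).
    rewrite big_const_seq count_predT iter_addr_0 -mulr_natr -/N.
    by field.
  have /choice[sigma sigE] t := to_mask (lconst (N / 4) * g' t).
  have four0 : (4 : R) != 0 by rewrite (pnatr_eq0 R 4).
  exists (fun=> N^-1), sigma; split.
  + rewrite fsbig_finite//= big_const_seq count_predT iter_addr_0 -mulr_natr.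
    by rewrite mulVf.
  + move=> t It; rewrite sigE// evalM lconstE.
    rewrite (_ : torus_point 1 1 =
        one_torus R); last by apply: val_inj; rewrite torus_pointK.
    by rewrite g'1 -rmorphM mulf_div (mulrC N) divff// mulf_neq0.
  + move=> z1 z2 z10 z20; have zK := torus_pointK z10 z20.
    transitivity (of_mask a (torus_point z1 z2)); first by rewrite of_maskE zK.
    rewrite g'E eval_sum fsbig_finite//; apply: eq_bigr => t _.
    rewrite evalM BE zK sigE// evalM lconstE.
    rewrite [RHS](_ : _ = (N^-1 * (N / 4) * 4)%:C *
      (g' t (torus_point z1 z2) * box_spline t z1 z2)).
      rewrite (_ : N^-1 * (N / 4) * 4 = 1) ?mul1r//.
      by rewrite mulrA mulVf// mul1r mulVf.
    by rewrite !rmorphM rmorph_nat /=; ring.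
- have aI (I : laurent R -> Prop) : is_ideal I ->
      (forall t, Iset k t -> I (monomial3 (factor1 R) (factor2 R)
          (factor12 R) t)) ->
      I (of_mask a).
    move=> [I0 ID IM] It.
    have -> : of_mask a = \sum_(t <- fset_set (Iset k))
        lconst (lam t) * of_mask (sigma t) * 4 * monomial3 (factor1 R)
            (factor2 R) (factor12 R) t.
      apply: laurentP => z; have [z10 z20] := torusP z.
      rewrite of_maskE aE// fsbig_finite// eval_sum; apply: eq_bigr => t _.
      by rewrite evalM box_splineE !evalM lconstE of_maskE mulrA.
    rewrite big_seq; elim/big_ind: _ => // t.
    by rewrite in_fset_set// inE => /It; exact: IM.
  split.
  + rewrite aE// fsbig_finite//.
    transitivity ((\sum_(t <- fset_set (Iset k)) lam t)%:C * 4).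
      rewrite rmorph_sum mulr_suml big_seq [RHS]big_seq; apply: eq_bigr => t.
      by rewrite in_fset_set// inE => It; rewrite sig1// box1 !mulr1.
    by rewrite -fsbig_finite// lam1 rmorph1 mul1r.
  + apply: aI => [|t /Iset_sums[_ xw _]]; first exact: is_ideal_pow.
    by rewrite /monomial3 (mulrC (_ ^+ t.1.1)); exact: ideal_pow_monomial.
  + apply: aI => [|t /Iset_sums[_ _ yw]]; first exact: is_ideal_pow.
    exact: ideal_pow_monomial.
  + apply: aI => [|t /Iset_sums[xy _ _]]; first exact: is_ideal_pow.
    by rewrite /monomial3 mulrC mulrA; exact: ideal_pow_monomial.
Qed.
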